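(* Let $R>0$, let $w$ be a pseudo-definite weight function on the disc $D_R$ with Fourier coefficients $w_{(k,\ell)}$, and let $f$ be a bounded function on the closed disc of radius $R$, with $\|f\|_\infty:=\sup_{x^2+y^2\le R^2}|f(x,y)|$. Then for all integers $N\ge1$, $M\ge1$, $K\ge0$, $$\left|I^{\mathrm{poly}}_{(N,M,K)}(f)\right|\le\sqrt{\pi}\,\|f\|_\infty\sum_{k=0}^{K}\sum_{\ell=1}^{a_k}\int_0^R|w_{(k,\ell)}(r)|\,r\,dr\le\sqrt{\pi}\,\|f\|_\infty\,\|w\| .$$ Also, if $\|w\|<\infty$, the coefficients of the cubature satisfy $$\frac{\pi}{M}\sum_{k=0}^{K}\sum_{\ell=1}^{a_k}\sum_{j=1}^{N}\sum_{s=1}^{M}\left|\lambda_{j,(k,\ell)}\,t_{j,(k,\ell)}^{-k/2}\,Y_{(k,\ell)}\!\left(\tfrac{2\pi s}{M}\right)\right|\le\sqrt{\pi}\,\|w\| .$$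
   Context: Points of the plane are written $re^{i\varphi}=(r\cos\varphi,r\sin\varphi)$; $D_R=\{x^2+y^2<R^2\}$. Put $a_0=1$, $a_k=2$ for $k\ge1$, $Y_{(0,1)}(\varphi)=1/\sqrt{2\pi}$, and for $k\ge1$: $Y_{(k,1)}(\varphi)=\frac1{\sqrt\pi}\cos k\varphi$, $Y_{(k,2)}(\varphi)=\frac1{\sqrt\pi}\sin k\varphi$. The weight $w$ is a real-valued function on $D_R$ (not necessarily non-negative), continuous except possibly at $0$. Its Fourier coefficients are $w_{(k,\ell)}(r)=\int_0^{2\pi}w(re^{i\varphi})Y_{(k,\ell)}(\varphi)\,d\varphi$ for $0<r<R$. It is called pseudo-definite if for each $(k,\ell)$ either $w_{(k,\ell)}(r)\ge0$ for all $r\in(0,R)$ or $w_{(k,\ell)}(r)\le0$ for all $r\in(0,R)$. Standing assumption: each $w_{(k,\ell)}$ is continuous on $(0,R)$ and $\int_0^R|w_{(k,\ell)}(r)|\,r\,dr<\infty$. Define $\|w\|:=\sum_{k=0}^\infty\sum_{\ell=1}^{a_k}\int_0^R|w_{(k,\ell)}(r)|\,r\,dr\in[0,\infty]$. For each $(k,\ell)$ with $w_{(k,\ell)}\not\equiv0$, the numbers $t_{1,(k,\ell)}<\dots<t_{N,(k,\ell)}$ in $(0,R^2)$ and $\lambda_{1,(k,\ell)},\dots,\lambda_{N,(k,\ell)}$ (all of the same sign) are the nodes and weights of the $N$-point Gauss quadrature determined by $$\sum_{j=1}^N\lambda_{j,(k,\ell)}t_{j,(k,\ell)}^{s}=\frac12\int_0^{R^2}\rho^s\,\rho^{k/2}w_{(k,\ell)}(\sqrt\rho)\,d\rho\qquad(0\le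 s\le 2N-1).$$ If $w_{(k,\ell)}\equiv0$, set all $\lambda_{j,(k,\ell)}=0$ (with arbitrary nodes in $(0,R^2)$). The discrete polyharmonic cubature with parameters $(N,M,K)$ is $$I^{\mathrm{poly}}_{(N,M,K)}(f)=\frac{\pi}{M}\sum_{k=0}^{K}\sum_{\ell=1}^{a_k}\sum_{j=1}^{N}\sum_{s=1}^{M}\lambda_{j,(k,\ell)}\,t_{j,(k,\ell)}^{-k/2}\,Y_{(k,\ell)}\!\left(\tfrac{2\pi s}{M}\right) f\!\left(\sqrt{t_{j,(k,\ell)}}\,e^{2\pi i s/M}\right).$$ *)

(* Defs.v *)
From HB Require Import structures.
From mathcomp Require Import all_boot all_order all_algebra.
From mathcomp Require Import all_classical all_reals all_analysis.

Set Implicit Arguments.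
Unset Strict Implicit.
Unset Printing Implicit Defensive.

Import Order.TTheory GRing.Theory Num.Theory.
Import numFieldNormedType.Exports.

Local Open Scope classical_set_scope.
Local Open Scope ring_scope.

Section Defs.
Variable R : realType.

Local Notation mu := (@lebesgue_measure R).

Definition polar (r phi : R) : R * R := (r * cos phi, r * sin phi).

Definition disc (rad : R) : set (R * R) :=
  [set p | p.1 ^+ 2 + p.2 ^+ 2 < rad ^+ 2].

Definition closed_disc (rad : R) : set (R * R) :=
  [set p | p.1 ^+ 2 + p.2 ^+ 2 <= rad ^+ 2].

Definition a_ (k : nat) : nat := if k == 0%N then 1%N else 2%N.

(* The second index l runs over 1, ..., a_ k; for other l the value of [Y] is
   irrelevant. *)
Definition is_index (k l : nat) : Prop := (1 <= l <= a_ k)%N.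

Definition Y (k l : nat) (phi : R) : R :=
  if k == 0%N then (Num.sqrt (2 * pi))^-1
  else if l == 1%N then (Num.sqrt pi)^-1 * cos (k%:R * phi)
  else (Num.sqrt pi)^-1 * sin (k%:R * phi).

(* Functions on a disc are total functions on the plane; their values off the
   disc play no role. *)
Definition fourier_coef (w : R * R -> R) (k l : nat) (r : R) : R :=
  Rintegral mu `[0, 2 * pi] (fun phi => w (polar r phi) * Y k l phi).

Definition coef_norm (rad : R) (w : R * R -> R) (k l : nat) : \bar R :=
  (\int[mu]_(r in `]0%R, rad[) (`|fourier_coef w k l r| * r)%:E)%E.

Definition weight_norm (rad : R) (w : R * R -> R) : \bar R :=
  (\sum_(0 <= k <oo) \sum_(1 <= l < (a_ k).+1) coef_norm rad w k l)%E.

(* The regularity of the Fourier coefficients is a standing assumption on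
   weight functions. *)
Definition weight (rad : R) (w : R * R -> R) : Prop :=
  {within disc rad `\ (0, 0), continuous w} /\
  forall k l, is_index k l ->
    {within `]0, rad[, continuous (fourier_coef w k l)} /\
    (coef_norm rad w k l < +oo)%E.

Definition pseudo_definite (rad : R) (w : R * R -> R) : Prop :=
  forall k l, is_index k l ->
    (forall r, 0 < r < rad -> 0 <= fourier_coef w k l r) \/
    (forall r, 0 < r < rad -> fourier_coef w k l r <= 0).

(* [c] is the radial function w_(k,l). *)
Definition gauss_quadrature (rad : R) (c : R -> R) (k N : nat)
    (t lam : 'I_N -> R) : Prop :=
  [/\ forall j, 0 < t j < rad ^+ 2,
      forall i j : 'I_N, (i < j)%N -> t i < t j,
      (forall j, 0 < lam j) \/ (forall j, lam j < 0)
    & forall s : nat, (s <= 2 * N - 1)%N ->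
        \sum_(j < N) lam j * t j ^+ s =
        2^-1 * Rintegral mu `]0, rad ^+ 2[
          (fun rho => rho ^+ s * rho `^ (k%:R / 2) * c (Num.sqrt rho))].

(* The family [t k l], [lam k l] of nodes and weights attached to [w]; when
   w_(k,l) vanishes identically the nodes are arbitrary, possibly repeated. *)
Definition gauss_family (rad : R) (w : R * R -> R) (N : nat)
    (t lam : nat -> nat -> 'I_N -> R) : Prop :=
  forall k l, is_index k l ->
    ((exists2 r, 0 < r < rad & fourier_coef w k l r != 0) ->
       gauss_quadrature rad (fourier_coef w k l) k (t k l) (lam k l)) /\
    ((forall r, 0 < r < rad -> fourier_coef w k l r = 0) ->
       forall j, 0 < t k l j < rad ^+ 2 /\ lam k l j = 0).

Definition angle (M s : nat) : R := 2 * pi * s%:R / M%:R.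

Definition cubature_coef (N M : nat) (t lam : nat -> nat -> 'I_N -> R)
    (k l : nat) (j : 'I_N) (s : nat) : R :=
  lam k l j * t k l j `^ (- (k%:R / 2)) * Y k l (angle M s).

Definition Ipoly (N M K : nat) (t lam : nat -> nat -> 'I_N -> R)
    (f : R * R -> R) : R :=
  pi / M%:R *
  \sum_(0 <= k < K.+1) \sum_(1 <= l < (a_ k).+1)
    \sum_(j < N) \sum_(1 <= s < M.+1)
      cubature_coef M t lam k l j s *
      f (polar (Num.sqrt (t k l j)) (angle M s)).

Definition sup_norm (rad : R) (f : R * R -> R) : R :=
  sup [set `|f p| | p in closed_disc rad].

End Defs.

(* Main.v *)
(* Everything reduces to the estimate
     sum_j |lambda_j| t_j^(-k/2) <= int_0^R |w_(k,l)(r)| r dr,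
   because |Y_(k,l)| <= 1 / sqrt pi. Let p be the polynomial of degree at most
   2N - 1 that interpolates t^(-k/2) doubly at the N nodes. The divided
   differences of t^(-k/2) alternate in sign, so t^(-k/2) - p(t) is the product
   of prod_j (t - t_j)^2 and a non-negative function. Hence, when w_(k,l) >= 0,
   the Gauss sum of t^(-k/2), which is that of p, is the integral of p, which is
   at most the integral of t^(-k/2) against rho^(k/2) w_(k,l)(sqrt rho) / 2, and
   rho = r^2 gives the bound. The case w_(k,l) <= 0 follows by negation. *)
Require Import Defs.
From HB Require Import structures.
From mathcomp Require Import all_boot all_order all_algebra.
From mathcomp Require Import all_classical all_reals all_analysis.
From mathcomp Require Import measurable_realfun ring.

Set Implicit Arguments.
Unset Strict Implicit.
Unset Printing Implicit Defensive.

Import Order.TTheory GRing.Theory Num.Theory.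
Import numFieldNormedType.Exports.

Local Open Scope classical_set_scope.
Local Open Scope ring_scope.

(** * Hermite interpolation of [t^(-k/2)] from below *)

(* A class of functions of [t], completely monotone in [t], that contains
   [t ^ (- k / 2)] and, thanks to
   [1/(u + a) - 1/(v + a) = (v^2 - u^2) / ((u + a) (v + a) (u + v))],
   is closed under negated divided differences. *)
Inductive sqrt_monotone (R : rcfType) : (R -> R) -> Prop :=
| sqrt_monotone_cst c : 0 <= c -> sqrt_monotone (fun=> c)
| sqrt_monotone_inv a : 0 <= a -> sqrt_monotone (fun t => (Num.sqrt t + a)^-1)
| sqrt_monotoneD f g : sqrt_monotone f -> sqrt_monotone g ->
    sqrt_monotone (fun t => f t + g t)
| sqrt_monotoneM f g : sqrt_monotone f -> sqrt_monotone g ->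
    sqrt_monotone (fun t => f t * g t).

Lemma sqrt_monotone_ge0 (R : rcfType) (f : R -> R) t :
  sqrt_monotone f -> 0 <= f t.
Proof.
elim=> // [a a0|g h _ g0 _ h0|g h _ g0 _ h0].
- by rewrite invr_ge0 addr_ge0 ?sqrtr_ge0.
- exact: addr_ge0.
- exact: mulr_ge0.
Qed.

(** Induction on the class. As [g] is given by a closed formula, the identity also covers [t = x],
    with [g x] in the role of the negated derivative. *)
Lemma sqrt_monotone_divided_difference (R : rcfType) (f : R -> R) x :
  0 < x -> sqrt_monotone f ->
  exists2 g, sqrt_monotone g & forall t, 0 < t -> f t = f x + (x - t) * g t.
Proof.
move=> x0; elim=> [c c0|a a0|f1 f2 _ [g1 Cg1 E1] _ [g2 Cg2 E2]|
    f1 f2 Cf1 [g1 Cg1 E1] Cf2 [g2 Cg2 E2]].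
- by exists (fun=> 0) => [|t _]; [exact: sqrt_monotone_cst|rewrite mulr0 addr0].
- have sx : 0 < Num.sqrt x by rewrite sqrtr_gt0.
  exists (fun t => (Num.sqrt x + a)^-1 *
      ((Num.sqrt t + a)^-1 * (Num.sqrt t + Num.sqrt x)^-1)).
    apply: sqrt_monotoneM.
      by apply: sqrt_monotone_cst; rewrite invr_ge0 addr_ge0 ?sqrtr_ge0.
    by apply: sqrt_monotoneM; apply: sqrt_monotone_inv => //; exact: ltW.
  move=> t t0; have st : 0 < Num.sqrt t by rewrite sqrtr_gt0.
  have -> : x - t = Num.sqrt x ^+ 2 - Num.sqrt t ^+ 2 by rewrite !sqr_sqrtr ?ltW.
  by field; rewrite !gt_eqF// ltr_wpDr.
- exists (fun t => g1 t + g2 t) => [|t t0]; first exact: sqrt_monotoneD.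
  by rewrite (E1 _ t0) (E2 _ t0); ring.
(* Leibniz rule for divided differences; the value [f1 x] is a non-negative constant, hence itself
   in the class. *)
- exists (fun t => f1 x * g2 t + f2 t * g1 t) => [|t t0].
    apply: sqrt_monotoneD; apply: sqrt_monotoneM => //.
    by apply: sqrt_monotone_cst; exact: sqrt_monotone_ge0.
  by rewrite {1}(E1 _ t0) {1}(E2 _ t0) (E2 _ t0); ring.
Qed.

(** Newton interpolation: each node splits off one factor [x - t] and leaves a quotient in the same
    class, so the final quotient is non-negative. Nodes may repeat. *)
Lemma sqrt_monotone_newton (R : rcfType) (f : R -> R) (xs : seq R) :
  sqrt_monotone f -> all (fun x => 0 < x) xs ->
  exists (p : {poly R}) (g : R -> R),
    [/\ (size p <= size xs)%N, sqrt_monotone g &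
      forall t, 0 < t -> f t = p.[t] + \prod_(x <- xs) (x - t) * g t].
Proof.
elim: xs f => [|x xs IH] f Cf /=.
  by exists 0, f; split=> [||t _]; rewrite ?size_poly0// big_nil horner0 add0r mul1r.
case/andP=> x0 /IH{}IH.
have [g /IH[p [h [sp Ch Eg]]] Ef] := sqrt_monotone_divided_difference x0 Cf.
exists ((f x)%:P + (x%:P - 'X) * p), h; split=> // [|t t0].
  rewrite (leq_trans (size_polyD _ _))// geq_max (leq_trans (size_polyC_leq1 _))//=.
  rewrite (leq_trans (size_polyMleq _ _))// -opprB size_polyN size_XsubC addSn/=.
  by rewrite add1n ltnS.
by rewrite (Ef _ t0) (Eg _ t0) big_cons !hornerE; ring.
Qed.

(** The summand [0] keeps the shape of [sqrt_monotone_inv] with [a = 0]. *)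
Lemma sqrt_monotone_exprVn (R : rcfType) k :
  sqrt_monotone (fun t : R => (Num.sqrt t + 0)^-1 ^+ k).
Proof.
elim: k => [|k IH]; first exact: sqrt_monotone_cst.
rewrite (_ : (fun _ => _) =
    fun t => (Num.sqrt t + 0)^-1 * (Num.sqrt t + 0)^-1 ^+ k); last first.
  by apply/funext => t; rewrite exprS.
by apply: sqrt_monotoneM => //; exact: sqrt_monotone_inv.
Qed.

Lemma powRN_half (R : realType) (k : nat) (x : R) : 0 < x ->
  x `^ (- (k%:R / 2)) = (Num.sqrt x + 0)^-1 ^+ k.
Proof.
move=> x0; rewrite addr0 powRN exprVn; congr (_^-1).
by rewrite mulrC powRrM powR12_sqrt ?powR_mulrn ?sqrtr_ge0// ltW.
Qed.

(** Newton interpolation with every node listed twice: the product over the nodes becomes a square,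
    so the remainder is non-negative, and the size bound [2 * N] is what Gauss quadrature integrates
    exactly. *)
Lemma hermite_minorant (R : realType) (k N : nat) (t : 'I_N -> R) :
  (forall j, 0 < t j) ->
  exists p : {poly R}, [/\ (size p <= 2 * N)%N,
    forall j, p.[t j] = t j `^ (- (k%:R / 2)) &
    forall x, 0 < x -> p.[x] <= x `^ (- (k%:R / 2))].
Proof.
move=> t0; pose s := [seq t j | j <- enum 'I_N].
have [|p [g [sp Cg E]]] :=
    sqrt_monotone_newton (xs := s ++ s) (sqrt_monotone_exprVn R k).
  by rewrite all_cat andbb; apply/allP => _ /mapP[j _ ->].
exists p; split=> [|j|x x0].
- by rewrite (leq_trans sp)// size_cat size_map size_enum_ord addnn mul2n.
- have sP : \prod_(x <- s ++ s) (x - t j) = 0.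
    apply/eqP; rewrite prodf_seq_eq0; apply/hasP.
    exists (t j); last by rewrite subrr eqxx.
    by rewrite mem_cat map_f ?mem_enum.
  by rewrite powRN_half// E// sP mul0r addr0.
- rewrite powRN_half// E// lerDl mulr_ge0 ?sqrt_monotone_ge0//.
  by rewrite big_cat/= -expr2 sqr_ge0.
Qed.

(** * The substitution [rho = r^2] *)

Section sqrt_substitution.
Variables (R : realType) (rad : R) (c : R -> R).
Hypothesis rad_gt0 : 0 < rad.
Hypothesis cc : {within `]0, rad[, continuous c}.
Local Notation mu := (@lebesgue_measure R).

Lemma sqrt_itv (x : R) : 0 < x < rad ^+ 2 -> 0 < Num.sqrt x < rad.
Proof.
case/andP=> x0 xr; rewrite sqrtr_gt0 x0/=.
by rewrite -(ger0_norm (ltW rad_gt0)) -sqrtr_sqr ltr_sqrt// exprn_gt0.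
Qed.

Lemma continuous_comp_sqrt :
  {in `]0, rad ^+ 2[%classic, continuous (c \o Num.sqrt)}.
Proof.
move=> x /[!inE]/= /[!in_itv]/= /sqrt_itv sx.
apply: continuous_comp; first exact: sqrt_continuous.
move: cc; rewrite continuous_open_subspace; last exact: interval_open.
by apply; rewrite inE/= in_itv.
Qed.

(** Stated on compact subintervals because [c] is continuous only on the open interval and may blow
    up at both ends. *)
Lemma integral_sqrt_substitution (a b : R) : 0 < a -> a <= b -> b < rad ->
  (\int[mu]_(x in `[(a ^+ 2)%R, (b ^+ 2)%R]) `|c (Num.sqrt x)|%:E =
   \int[mu]_(r in `[a, b]) (`|c r| * (2 * r))%R%:E)%E.
Proof.
move=> a0 ab br.
have dX (x : R) : is_derive x 1 (fun y : R => y ^+ 2) (2 * x).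
  by apply: is_derive_eq; rewrite /= /GRing.scale/=; ring.
have dE : (fun y : R => y ^+ 2)^`()%classic = (fun x => 2 * x).
  by apply/funext => x; rewrite derive1E derive_val.
have c2 : continuous (fun x : R => 2 * x).
  by move=> x; apply: cvgM; [exact: cvg_cst|exact: cvg_id].
have cX : continuous (fun x : R => x ^+ 2) by exact: exprn_continuous.
rewrite (@integration_by_substitution_increasing _ (fun y : R => y ^+ 2)
  (fun x => `|c (Num.sqrt x)|) _ _ ab).
- apply: eq_integral => x /[!inE]/= /[!in_itv]/= /andP[ax _].
  by rewrite /= dE fctE/= sqrtr_sqr (ger0_norm (le_trans (ltW a0) ax)).
- move=> x y; rewrite !in_itv/= => /andP[ax _] _ xy.
  by rewrite ltr_pXn2r// nnegrE (le_trans (ltW a0))// (le_trans ax)// ltW.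
- by rewrite dE => x _; exact: c2.
- by rewrite dE; apply/cvg_ex; exists (2 * a); apply: cvg_at_right_filter; exact: c2.
- by rewrite dE; apply/cvg_ex; exists (2 * b); apply: cvg_at_left_filter; exact: c2.
- split=> [x _||].
  + by have [] := dX x.
  + by apply: cvg_at_right_filter; exact: cX.
  + by apply: cvg_at_left_filter; exact: cX.
- apply: continuous_in_subspaceT => x /[!inE]/= /[!in_itv]/= /andP[ax xb].
  apply: (@continuous_comp _ _ _ (c \o Num.sqrt) Num.norm); last exact: norm_continuous.
  apply: continuous_comp_sqrt; rewrite inE/= in_itv/=.
  rewrite (lt_le_trans _ ax) ?exprn_gt0//= (le_lt_trans xb)//.
  by rewrite ltr_pXn2r// nnegrE ltW// (lt_le_trans a0).
Qed.

Lemma measurable_comp_sqrt : measurable_fun `]0, rad ^+ 2[ (c \o Num.sqrt).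
Proof.
apply: open_continuous_measurable_fun; first exact: interval_open.
exact: continuous_comp_sqrt.
Qed.

(** Compact intervals exhaust the open one. On each of them the substitution applies, and its right
    side is at most the integral over all of []0, rad[]; monotone convergence then gives the
    bound. *)
Lemma le_integral_sqrt_substitution :
  (\int[mu]_(x in `]0%R, (rad ^+ 2)%R[) `|c (Num.sqrt x)|%:E <=
   2%:E * \int[mu]_(r in `]0%R, rad[) (`|c r| * r)%R%:E)%E.
Proof.
(* The offset 2 makes [d n] at most half of [rad], so every [D n] is non-empty, including [D 0]. *)
pose d n := rad / n.+2%:R.
pose D n := `[d n ^+ 2, (rad - d n) ^+ 2]%classic.
have mc : measurable_fun `]0, rad[ c.
  apply: open_continuous_measurable_fun; first exact: interval_open.
  by move: cc; rewrite continuous_open_subspace//; exact: interval_open.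
have d0 n : 0 < d n by rewrite divr_gt0.
have dr n : d n <= rad - d n.
  rewrite lerBrDr /d -mulrDl ler_pdivrMr// -mulr2n -(mulr_natr rad).
  by rewrite ler_pM2l// ler_nat.
have drr n : rad - d n < rad by rewrite ltrBlDr ltrDl.
have rd0 n : 0 < rad - d n by rewrite (lt_le_trans (d0 n)).
have dS m n : (m <= n)%N -> d n <= d m.
  by move=> mn; rewrite ler_pM2l// lef_pV2 ?posrE// ler_nat !ltnS.
have DE : \bigcup_n D n = `]0, rad ^+ 2[%classic.
  apply/seteqP; split=> [x [n _]|x]; rewrite /D/= !in_itv/=.
    case/andP=> dx xd; rewrite (lt_le_trans _ dx) ?exprn_gt0//=.
    by rewrite (le_lt_trans xd)// ltr_pXn2r// nnegrE ltW.
  move=> /[dup] x0r /sqrt_itv /andP[s0 sr].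
  (* The margin [d n] must not exceed the distance from the root of [x] to either end of the
     interval. *)
  have [n nP] : exists n, d n <= Num.min (Num.sqrt x) (rad - Num.sqrt x).
    set e := Num.min _ _.
    have e0 : 0 < e by rewrite lt_min s0 subr_gt0.
    exists (Num.truncn (rad / e)).
    rewrite /d ler_pdivrMr// mulrC -ler_pdivrMr//.
    rewrite (le_trans (ltW (truncnS_gt _)))// ler_nat.
    by rewrite ltnS leqnSn.
  move: nP; rewrite le_min lerBrDr -lerBrDl => /andP[n1 n2].
  exists n => //=; rewrite in_itv/= -(sqr_sqrtr (_ : 0 <= x)); last first.
    by case/andP: x0r => /ltW.
  by rewrite !ler_pXn2r ?nnegrE ?n1 ?n2 ?sqrtr_ge0 ?ltW.
have DS n : D n `<=` `]0, rad ^+ 2[ by rewrite -DE; exact: bigcup_sup.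
have mcs : measurable_fun `]0, rad ^+ 2[ (fun x => `|c (Num.sqrt x)|%:E).
  by apply/measurable_EFinP/measurableT_comp => //; exact: measurable_comp_sqrt.
have cv : (\int[mu]_(x in D n) `|c (Num.sqrt x)|%:E @[n --> \oo] -->
    \int[mu]_(x in \bigcup_n D n) `|c (Num.sqrt x)|%:E)%E.
  apply: ge0_nondecreasing_set_cvg_integral => [m n mn|n|n|n x _].
  - apply/subsetPset => x; rewrite /D/= !in_itv/= => /andP[dx xd].
    rewrite (le_trans _ dx) ?(le_trans xd)//.
    + by rewrite ler_pXn2r ?nnegrE ?(ltW (rd0 _))// lerD2l lerN2 dS.
    + by rewrite ler_pXn2r ?nnegrE ?(ltW (d0 _))// dS.
  - exact: measurable_itv.
  - exact: measurable_funS (DS n) mcs.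
  - by rewrite lee_fin.
rewrite -DE -(cvg_lim _ cv)//.
  apply: lime_le; first by apply/cvg_ex; eexists; exact: cv.
  apply: nearW => n; rewrite integral_sqrt_substitution// -ge0_integralZl//; last 2 first.
  - apply/measurable_EFinP/measurable_funM => //.
    exact: measurableT_comp.
  - by move=> r /=; rewrite in_itv/= lee_fin => /andP[/ltW r0 _]; rewrite mulr_ge0.
  under [leRHS]eq_integral do rewrite -EFinM mulrCA.
  apply: ge0_subset_integral => //.
  - apply/measurable_EFinP/measurable_funM => //.
      exact: measurableT_comp.
  - by move=> r /=; rewrite in_itv/= lee_fin => /andP[/ltW r0 _]; rewrite !mulr_ge0.
  - move=> r /=; rewrite !in_itv/= => /andP[dr_ rd].
    by rewrite (lt_le_trans (d0 n))//= (le_lt_trans rd).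
Qed.
End sqrt_substitution.

(** * Gauss quadrature for a density of constant sign *)

(** Induction on the size bound, removing the monomial of degree [n]. Integrability is carried along
    because additivity of [Rintegral] requires it. *)
Lemma Rintegral_poly (R : realType) (D : set R) (u : R -> R) (p : {poly R}) n :
  measurable D -> (size p <= n)%N ->
  (forall s : nat, (s < n)%N ->
    (@lebesgue_measure R).-integrable D (fun x => (x ^+ s * u x)%:E)) ->
  (@lebesgue_measure R).-integrable D (fun x => (p.[x] * u x)%:E) /\
  Rintegral (@lebesgue_measure R) D (fun x => p.[x] * u x) =
  \sum_(s < n) p`_s * Rintegral (@lebesgue_measure R) D (fun x => x ^+ s * u x).
Proof.
move=> mD; elim: n p => [|n IH] p sp iu.
  move: sp; rewrite leqn0 size_poly_eq0 => /eqP ->.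
  under eq_fun do rewrite horner0 mul0r.
  rewrite big_ord0; split; first exact: integrable0.
  by under eq_Rintegral do rewrite horner0 mul0r; rewrite Rintegral_cst// mul0r.
have [|s sn|iq Eq] := IH (p - p`_n *: 'X^n).
- apply/leq_sizeP => i ni; rewrite !coefE; case: eqP => [->|/eqP ni'].
    by rewrite mulr1 subrr.
  by rewrite mulr0 subr0 nth_default// (leq_trans sp)// ltn_neqAle eq_sym ni'.
- by apply: iu; rewrite ltnS ltnW.
have E x : p.[x] * u x = (p - p`_n *: 'X^n).[x] * u x + p`_n * (x ^+ n * u x).
  by rewrite hornerD hornerN hornerZ hornerXn; ring.
have iM : (@lebesgue_measure R).-integrable D
    (EFin \o (fun x => p`_n * (x ^+ n * u x))).
  rewrite (_ : _ \o _ = fun x => (p`_n)%:E * (x ^+ n * u x)%:E)%E//.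
  exact/integrableZl/iu.
split.
  under eq_fun do rewrite E EFinD.
  exact: integrableD.
under eq_Rintegral do rewrite E.
rewrite RintegralD// Eq big_ord_recr/= RintegralZl//; last exact: iu.
congr (_ + _); apply: eq_bigr => i _; rewrite !coefE.
by rewrite (ltn_eqF (ltn_ord i)) mulr0 subr0.
Qed.

Section gauss.
Variables (R : realType) (rad : R) (c : R -> R) (k N : nat) (t lam : 'I_N -> R).
Hypothesis rad_gt0 : 0 < rad.
Hypothesis N_gt0 : (0 < N)%N.
Hypothesis cc : {within `]0, rad[, continuous c}.
Hypothesis c_fin :
  (\int[@lebesgue_measure R]_(r in `]0%R, rad[) (`|c r| * r)%R%:E < +oo)%E.
Hypothesis c_ge0 : forall r, 0 < r < rad -> 0 <= c r.
Hypothesis gq : gauss_quadrature rad c k t lam.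
Local Notation mu := (@lebesgue_measure R).

Let D := `]0, rad ^+ 2[%classic.

Let mD : measurable D. Proof. exact: measurable_itv. Qed.

Lemma integrable_comp_sqrt : mu.-integrable D (fun x => (c (Num.sqrt x))%:E).
Proof.
apply/integrableP; split.
  by apply/measurable_EFinP; exact: measurable_comp_sqrt.
apply: le_lt_trans (le_integral_sqrt_substitution rad_gt0 cc) _.
by rewrite lte_mul_pinfty.
Qed.

Lemma integrable_moment (s : nat) : mu.-integrable D
  (fun x => (x ^+ s * (x `^ (k%:R / 2) * c (Num.sqrt x)))%:E).
Proof.
(* Both powers increase with [x], so their product is bounded by its value at the right endpoint. *)
pose B := (rad ^+ 2) ^+ s * (rad ^+ 2) `^ (k%:R / 2).
apply: (@le_integrable _ _ _ mu D _ _ (fun x => (B%:E * (c (Num.sqrt x))%:E)%E)) => //.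
- apply/measurable_EFinP/measurable_funM; first exact: exprn_measurable.
  apply: measurable_funM; last exact: measurable_comp_sqrt.
  exact: measurable_funTS (measurable_powR _).
- move=> x; rewrite /D/= in_itv/= => /andP[/ltW x0 /ltW xr].
  have xB : x ^+ s * x `^ (k%:R / 2) <= B.
    rewrite ler_pM ?exprn_ge0 ?powR_ge0//.
      by rewrite lerXn2r ?nnegrE ?exprn_ge0// ltW.
    by rewrite ge0_ler_powR ?nnegrE ?exprn_ge0 ?divr_ge0// ltW.
  have xP : 0 <= x ^+ s * x `^ (k%:R / 2) by rewrite mulr_ge0 ?exprn_ge0 ?powR_ge0.
  rewrite lee_fin mulrA normrM (normrM B) ler_wpM2r//.
  by rewrite !ger0_norm// (le_trans xP).
- exact: integrableZl integrable_comp_sqrt.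
Qed.

Lemma gauss_quadrature_poly (p : {poly R}) : (size p <= 2 * N)%N ->
  mu.-integrable D
    (fun x => (p.[x] * (x `^ (k%:R / 2) * c (Num.sqrt x)))%:E) /\
  \sum_(j < N) lam j * p.[t j] =
  2^-1 * Rintegral mu D (fun x => p.[x] * (x `^ (k%:R / 2) * c (Num.sqrt x))).
Proof.
case: gq => _ _ _ mom sp.
have [? ->] := Rintegral_poly (measurable_itv `]0, rad ^+ 2[) sp
  (fun s _ => integrable_moment s).
split=> //; rewrite mulr_sumr.
under eq_bigr => j _ do rewrite (horner_coef_wide _ sp) mulr_sumr.
rewrite exchange_big/=; apply: eq_bigr => s _.
under eq_bigr => j _ do rewrite mulrCA.
(* Passing from [s < 2 * N] to [s <= 2 * N - 1] uses [N > 0], the subtraction being truncated. *)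
rewrite -mulr_sumr mom; last by rewrite subn1 -ltnS prednK ?muln_gt0.
rewrite mulrCA; do 2 congr (_ * _); apply: eq_Rintegral => x _.
by rewrite mulrA.
Qed.

(** The weights share one sign, and their sum, the zeroth moment, is non-negative; all weights
    negative would contradict this. *)
Lemma gauss_weight_gt0 j : 0 < lam j.
Proof.
case: gq => _ _ [//|lam0] mom.
have : 0 <= \sum_(j < N) lam j * t j ^+ 0.
  rewrite mom// mulr_ge0 ?invr_ge0//; apply: Rintegral_ge0 => x.
  rewrite /= in_itv/= => x0r; rewrite !mulr_ge0 ?powR_ge0 ?exprn_ge0//.
    by case/andP: x0r => /ltW.
  by apply/c_ge0/sqrt_itv.
rewrite leNgt (_ : _ < _ = true)//.
under eq_bigr do rewrite mulr1.
rewrite (bigD1 j)//= (le_lt_trans _ (lam0 j))// gerDl sumr_le0// => i _.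
exact: ltW.
Qed.

Lemma gauss_le_coef_norm :
  ((\sum_(j < N) `|lam j| * t j `^ (- (k%:R / 2)))%:E <=
   \int[mu]_(r in `]0%R, rad[) (`|c r| * r)%R%:E)%E.
Proof.
have t0 j : 0 < t j by case: gq => /(_ j)/andP[].
have [p [sp pt px]] := hermite_minorant k t0.
have [ip Ep] := gauss_quadrature_poly sp.
under eq_bigr => j _ do rewrite (gtr0_norm (gauss_weight_gt0 j)) -pt.
rewrite Ep.
have ic := integrable_comp_sqrt.
(* The factor 2 from [drho = 2 r dr] cancels the one half in the moments. *)
apply: (@le_trans _ _ (2^-1%:E * \int[mu]_(x in D) `|c (Num.sqrt x)|%:E)%E); last first.
  apply: (@le_trans _ _ (2^-1%:E * (2%:E *
      \int[mu]_(r in `]0%R, rad[) (`|c r| * r)%R%:E))%E).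
    by rewrite lee_wpmul2l ?lee_fin ?invr_ge0// le_integral_sqrt_substitution.
  by rewrite muleA -EFinM mulVf// mul1e.
rewrite EFinM lee_wpmul2l ?lee_fin ?invr_ge0//.
rewrite (_ : (\int[mu]_(x in D) `|c (Num.sqrt x)|%:E)%E =
  (Rintegral mu D (fun x => c (Num.sqrt x)))%:E); last first.
  rewrite fineK; last exact: integrable_fin_num.
  apply: eq_integral => x /[!inE]; rewrite /D/= in_itv/= => /(sqrt_itv rad_gt0).
  by move/c_ge0/ger0_norm ->.
rewrite lee_fin; apply: le_Rintegral => // x; rewrite /D/= in_itv/= => x0r.
(* What remains is that [p.[x]] times [x^(k/2)] is at most 1, which follows from [p.[x] <=
   x^(-k/2)]. *)
rewrite mulrA ler_piMl//; first exact/c_ge0/sqrt_itv.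
have x0 : 0 < x by case/andP: x0r.
rewrite (le_trans (ler_wpM2r (powR_ge0 _ _) (px _ x0)))//.
by rewrite -powRD ?addNr ?powRr0// (gt_eqF x0) implybT.
Qed.
End gauss.

(** Reduces non-positive densities to non-negative ones; integrability of the moments lets the sign
    leave the integral. *)
Lemma gauss_quadratureN (R : realType) (rad : R) (c : R -> R) k N
    (t lam : 'I_N -> R) :
  gauss_quadrature rad c k t lam ->
  (forall s : nat, (@lebesgue_measure R).-integrable `]0, rad ^+ 2[ (fun x =>
     (x ^+ s * (x `^ (k%:R / 2) * c (Num.sqrt x)))%:E)) ->
  gauss_quadrature rad (fun r => - c r) k t (fun j => - lam j).
Proof.
move=> [tD tlt lamP mom] ic; split=> // [|s sN].
  by case: lamP => lamP; [right|left] => j; rewrite ?oppr_lt0 ?oppr_gt0.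
under eq_bigr do rewrite mulNr.
rewrite sumrN mom// -mulrN -[X in _ * X]mulN1r -RintegralZl//.
  by congr (_ * _); apply: eq_Rintegral => x _; rewrite mulN1r mulrN.
by apply: eq_integrable (ic s) => // x _; rewrite /= mulrA.
Qed.

(** * From the radial estimates to the cubature *)

Section coefficients.
Variables (R : realType) (rad : R) (w : R * R -> R) (N : nat).
Variables t lam : nat -> nat -> 'I_N -> R.
Hypothesis rad_gt0 : 0 < rad.
Hypothesis hw : weight rad w.
Hypothesis hpd : pseudo_definite rad w.
Hypothesis N_gt0 : (0 < N)%N.
Hypothesis hg : gauss_family rad w t lam.
Local Notation mu := (@lebesgue_measure R).

Let L k l := \sum_(j < N) `|lam k l j| * t k l j `^ (- (k%:R / 2)).

Lemma coef_norm_ge0 k l : (0 <= coef_norm rad w k l)%E.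
Proof.
apply: integral_ge0 => r; rewrite /= in_itv/= lee_fin => /andP[/ltW r0 _].
by rewrite mulr_ge0.
Qed.

Lemma gauss_family_le_coef_norm k l : is_index k l ->
  ((L k l)%:E <= coef_norm rad w k l)%E.
Proof.
rewrite /L => kl; have [cc cfin] := hw.2 k l kl; have [gq lam0] := hg kl.
have [c_neq0|c0] := pselect (exists2 r, 0 < r < rad & fourier_coef w k l r != 0).
  have {}gq := gq c_neq0.
  have [c_ge0|c_le0] := hpd kl; first exact: gauss_le_coef_norm gq.
  have gqN := gauss_quadratureN gq (integrable_moment k rad_gt0 cc cfin).
  have cE (r : R) : `|fourier_coef w k l r| = `|- fourier_coef w k l r| by rewrite normrN.
  rewrite /coef_norm; under eq_integral do rewrite cE.
  under eq_bigr do rewrite -normrN.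
  apply: gauss_le_coef_norm gqN => // [||r /c_le0]; last by rewrite oppr_ge0.
  - by move=> r; apply: cvgN; exact: cc.
  - by under eq_integral do rewrite normrN.
(* Identically vanishing coefficient: all weights are 0, so the left side is 0. *)
rewrite big1 ?coef_norm_ge0// => j _.
have [|_ ->] := lam0 _ j; last by rewrite normr0 mul0r.
by move=> r r0; apply: contra_notP c0 => /eqP cr; exists r.
Qed.

Lemma normr_Y_le k l phi : `|Y k l phi| <= (Num.sqrt pi)^-1 :> R.
Proof.
have sp : 0 < Num.sqrt (pi : R) by rewrite sqrtr_gt0 pi_gt0.
rewrite /Y; case: ifP => _.
  rewrite ger0_norm ?invr_ge0 ?sqrtr_ge0// lef_pV2 ?posrE//; last first.
    by rewrite sqrtr_gt0 mulr_gt0 ?pi_gt0.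
  by rewrite ler_sqrt ?mulr_ge0 ?pi_ge0// ler_peMl ?pi_ge0// ler1n.
case: ifP => _; rewrite normrM gtr0_norm ?invr_gt0// ler_piMr ?invr_ge0 ?(ltW sp)//.
  by rewrite ler_norml cos_geN1 cos_le1.
by rewrite ler_norml sin_geN1 sin_le1.
Qed.

Lemma sum_normr_cubature_coef_le M K : (0 < M)%N ->
  ((pi / M%:R *
    \sum_(0 <= k < K.+1) \sum_(1 <= l < (a_ k).+1)
      \sum_(j < N) \sum_(1 <= s < M.+1)
        `|cubature_coef M t lam k l j s|)%:E <=
   (Num.sqrt pi)%:E *
     \sum_(0 <= k < K.+1) \sum_(1 <= l < (a_ k).+1) coef_norm rad w k l)%E.
Proof.
move=> M0; have sp : 0 < Num.sqrt (pi : R) by rewrite sqrtr_gt0 pi_gt0.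
apply: (@le_trans _ _ ((Num.sqrt pi)%:E *
    (\sum_(0 <= k < K.+1) \sum_(1 <= l < (a_ k).+1) L k l)%:E)%E).
  rewrite -EFinM lee_fin.
  (* The [M] angles contribute at most [1 / sqrt pi] each, which the prefactor [pi / M] turns into
     [sqrt pi]. *)
  have -> : Num.sqrt (pi : R) = pi / M%:R * (M%:R / Num.sqrt pi).
    rewrite mulrA divfK ?pnatr_eq0 -?lt0n// -{2}(sqr_sqrtr (pi_ge0 R)).
    by rewrite expr2 mulfK ?gt_eqF.
  rewrite -[leRHS]mulrA ler_wpM2l ?divr_ge0 ?pi_ge0//.
  rewrite mulr_sumr ler_sum// => k _; rewrite mulr_sumr ler_sum// => l _.
  rewrite mulr_sumr ler_sum// => j _.
  apply: (@le_trans _ _ (\sum_(1 <= s < M.+1)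
      (`|lam k l j| * t k l j `^ (- (k%:R / 2)) / Num.sqrt pi))).
    apply: ler_sum => s _; rewrite /cubature_coef !normrM (ger0_norm (powR_ge0 _ _)).
    by rewrite ler_wpM2l ?mulr_ge0 ?powR_ge0// normr_Y_le.
  by rewrite sumr_const_nat subn1/= -[leLHS]mulr_natl mulrCA [leRHS]mulrC mulrA.
rewrite lee_wpmul2l ?lee_fin ?sqrtr_ge0// -sumEFin; apply: lee_sum => k _.
rewrite -sumEFin big_nat_cond [leRHS]big_nat_cond; apply: lee_sum => l /andP[kl _].
by apply: gauss_family_le_coef_norm; rewrite /is_index -ltnS.
Qed.

Lemma sum_coef_norm_le_weight_norm K :
  (\sum_(0 <= k < K.+1) \sum_(1 <= l < (a_ k).+1) coef_norm rad w k l <=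
   weight_norm rad w)%E.
Proof.
apply: nneseries_lim_ge => k _ _; apply: sume_ge0 => l _; exact: coef_norm_ge0.
Qed.

Lemma normr_le_sup_norm (f : R * R -> R) p :
  [bounded f p | p in closed_disc rad] -> closed_disc rad p ->
  `|f p| <= sup_norm rad f.
Proof.
(* Boundedness says that every number beyond some [B] is a bound; [B + 1] is one, so the supremum is
   a genuine upper bound. *)
move=> [B [_ /(_ (B + 1))]] + pD; rewrite ltrDl ltr01 => /(_ isT) fB.
by apply: ub_le_sup; [exists (B + 1) => _ [q qD <-]; exact: fB|exists p].
Qed.

Lemma normr_Ipoly_le (f : R * R -> R) M K :
  [bounded f p | p in closed_disc rad] ->
  `|Ipoly M K t lam f| <= sup_norm rad f * (pi / M%:R *
    \sum_(0 <= k < K.+1) \sum_(1 <= l < (a_ k).+1)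
      \sum_(j < N) \sum_(1 <= s < M.+1)
        `|cubature_coef M t lam k l j s|).
Proof.
move=> bf; rewrite /Ipoly normrM mulrCA ger0_norm ?divr_ge0 ?pi_ge0//.
rewrite ler_wpM2l ?divr_ge0 ?pi_ge0//.
rewrite (le_trans (ler_norm_sum _ _ _))// mulr_sumr ler_sum// => k _.
rewrite (le_trans (ler_norm_sum _ _ _))// mulr_sumr.
rewrite big_nat_cond [leRHS]big_nat_cond; apply: ler_sum => l /andP[kl _].
rewrite (le_trans (ler_norm_sum _ _ _))// mulr_sumr ler_sum// => j _.
rewrite (le_trans (ler_norm_sum _ _ _))// mulr_sumr ler_sum// => s _.
rewrite normrM mulrC ler_wpM2r//; apply: normr_le_sup_norm => //.
(* Whether or not the coefficient vanishes, the nodes lie in []0, rad ^+ 2[], so [f] is evaluated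
   inside the disc. *)
have [t0 tr] : 0 < t k l j /\ t k l j < rad ^+ 2.
  have kl' : is_index k l by rewrite /is_index -ltnS.
  have [gq lam0] := hg kl'; apply/andP.
  have [/gq[]//|c0] :=
    pselect (exists2 r, 0 < r < rad & fourier_coef w k l r != 0).
  have [|//] := lam0 _ j.
  by move=> r r0; apply: contra_notP c0 => /eqP cr; exists r.
by rewrite /closed_disc/polar/= !exprMn -mulrDr cos2Dsin2 mulr1 sqr_sqrtr ltW.
Qed.
End coefficients.

Theorem theorem2 (R : realType) (rad : R) (w f : R * R -> R) (N M K : nat)
    (t lam : nat -> nat -> 'I_N -> R)
    (hrad : 0 < rad)
    (hw : weight rad w)
    (hpd : pseudo_definite rad w)
    (hf : [bounded f p | p in closed_disc rad])
    (hN : (1 <= N)%N) (hM : (1 <= M)%N)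
    (hg : gauss_family rad w t lam) :
  [/\ (`|Ipoly M K t lam f|%:E <=
       (Num.sqrt pi * sup_norm rad f)%:E *
       \sum_(0 <= k < K.+1) \sum_(1 <= l < (a_ k).+1) coef_norm rad w k l)%E,
      ((Num.sqrt pi * sup_norm rad f)%:E *
       (\sum_(0 <= k < K.+1) \sum_(1 <= l < (a_ k).+1) coef_norm rad w k l) <=
       (Num.sqrt pi * sup_norm rad f)%:E * weight_norm rad w)%E
    & (weight_norm rad w < +oo)%E ->
      ((pi / M%:R *
        \sum_(0 <= k < K.+1) \sum_(1 <= l < (a_ k).+1)
          \sum_(j < N) \sum_(1 <= s < M.+1)
            `|cubature_coef M t lam k l j s|)%:E <=
       (Num.sqrt pi)%:E * weight_norm rad w)%E].
Proof.
(* The origin lies in the closed disc, so the supremum dominates an absolute value. *)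
have f0 : 0 <= sup_norm rad f.
  apply: le_trans (normr_ge0 (f (0, 0))) _; apply: normr_le_sup_norm => //.
  by rewrite /closed_disc/= expr0n addr0 exprn_ge0// ltW.
have S_le := sum_normr_cubature_coef_le hrad hw hpd hN hg K hM.
have W_le := sum_coef_norm_le_weight_norm rad w K.
split.
- rewrite [X in (_ <= X%:E * _)%E]mulrC EFinM -muleA.
  apply: le_trans (lee_wpmul2l _ S_le); last by rewrite lee_fin.
  by rewrite -EFinM lee_fin; exact: normr_Ipoly_le hg _ _ _ hf.
- by apply: lee_wpmul2l => //; rewrite lee_fin mulr_ge0 ?sqrtr_ge0.
- by move=> _; rewrite (le_trans S_le)// lee_wpmul2l// lee_fin sqrtr_ge0.
Qed.
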